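(* Let $f\in C^0([-1,1]\times\mathbb R,\mathbb R)$ and suppose there exists $r_\infty\in C^1[-1,1]$ such that $$\lim_{|\xi|\to\infty}\frac{f(x,\xi)}{\xi}=r_\infty(x)>0,\quad\text{uniformly for }x\in[-1,1].$$ Suppose that $|\alpha^\pm|<\gamma(r_\infty)$, and let $\lambda_k^\infty:=\lambda_k(r_\infty)$, $k\ge1$. If $\lambda_k^\infty\ne1$ for all $k\ge1$, then the problem $$-u''=f(\cdot,u)\ \text{ on }(-1,1),\qquad u\in X,$$ has a solution.
   Context: Integers $m^\pm\ge1$ and points $\eta_i^\pm\in[-1,1]$, $i=1,\dots,m^\pm$, with $\eta_i^+\ne1$, $\eta_i^-\ne-1$, are fixed. The coefficients are $\alpha^\pm=(\alpha_1^\pm,\dots,\alpha_{m^\pm}^\pm)\in\mathbb R^{m^\pm}$, $\boldsymbol\alpha=(\alpha^-,\alpha^+)$. For $\alpha\in\mathbb R^m$, $|\alpha|:=\sum_{i=1}^m|\alpha_i|$. For $\gamma>0$, $\mathcal A_\gamma:=\{\boldsymbol\alpha:|\alpha^-|<\gamma\text{ and }|\alpha^+|<\gamma\}$. $X:=\{u\in C^2[-1,1]: u(\pm1)=\sum_{i=1}^{m^\pm}\alpha_i^\pm u(\eta_i^\pm)\}$ (both boundary conditions hold), with the $C^2$ norm; $Y:=C^0[-1,1]$ with the sup norm; $\Delta:X\to Y$, $\Delta u:=u''$. It is known that if $|\alpha^\pm|<1$ then $\Delta$ is bijective with continuous inverse, and $\Delta^{-1}:Y\to C^1[-1,1]$ is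 compact; put $K_ru:=-\Delta^{-1}(ru)$, $u\in Y$. For $k\ge1$ and $\nu\in\{+,-\}$, $T_k^\nu\subset X$ is the set of $u\in X$ such that: (a) $u'(\pm1)\ne0$ and $\nu u'(-1)>0$; (b) $u'$ has only simple zeros in $(-1,1)$, and has exactly $k$ such zeros; (c) $u$ has a zero strictly between each pair of consecutive zeros of $u'$. Eigenvalues: for $r\in C^1[-1,1]$, $r>0$, a number $\lambda\in\mathbb R$ is an eigenvalue if $-u''=\lambda ru$ has a non-trivial solution $u\in X$ (an eigenfunction); it is simple if $\dim\bigcup_{l\ge1}N((I_Y-\lambda K_r)^l)=1$. For each such $r$ there exists a constant $\gamma(r)\in(0,1]$ such that, whenever $\boldsymbol\alpha\in\mathcal A_{\gamma(r)}$, the set of eigenvalues consists of a strictly increasing sequence of simple eigenvalues $\lambda_k(r)>0$, $k\ge1$, with $\lambda_k(r)\to\infty$, and $\lambda_k(r)$ has an eigenfunction in $T_k^+$. Here $\gamma(r)$ denotes such a (fixed) constant and $\lambda_k(r)$ the corresponding eigenvalues. *)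

(* Defs.v *)
From HB Require Import structures.
From mathcomp Require Import all_boot all_order all_algebra.
From mathcomp Require Import all_classical all_reals all_analysis.
Set Implicit Arguments.
Unset Strict Implicit.
Unset Printing Implicit Defensive.
Import Order.TTheory GRing.Theory Num.Theory.
Import numFieldNormedType.Exports.
Local Open Scope classical_set_scope.
Local Open Scope ring_scope.

(* A function on [-1, 1] is represented by a function R -> R of which only the
   values on [-1, 1] matter: every condition below depends on these values
   only, and equality in C^0[-1, 1] is pointwise equality on [-1, 1]. *)

(* Difference quotient of u at x, the increment staying in [-1, 1]: the
   derivative is two-sided in (-1, 1) and one-sided at -1 and 1. *)
Definition dquot (R : realType) (u : R -> R) (x : R) : set_system R :=
  (u y - u x) / (y - x) @[y --> within `[-1, 1] x^'].

Definition deriv_I (R : realType) (u : R -> R) (x : R) : R :=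
  lim (dquot u x).

(* u belongs to C^k[-1, 1]. *)
Fixpoint C_I (R : realType) (k : nat) (u : R -> R) : Prop :=
  if k is k'.+1 then
    {in `[-1, 1], forall x, cvg (dquot u x)} /\ C_I k' (deriv_I u)
  else {within `[-1, 1], continuous u}.

Definition nontrivial_I (R : realType) (u : R -> R) : Prop :=
  exists2 x, x \in `[-1, 1] & u x != 0.

Definition l1norm (R : realType) (m : nat) (a : 'rV[R]_m) : R :=
  \sum_(i < m) `|a 0 i|.

(* In all that follows, the suffixes m and p stand for the superscripts
   "minus" and "plus". *)

Definition A_ (R : realType) (mm mp : nat) (gamma : R) :
    set ('rV[R]_mm * 'rV[R]_mp) :=
  [set alpha | l1norm alpha.1 < gamma /\ l1norm alpha.2 < gamma].

Definition X_ (R : realType) (mm mp : nat)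
    (etam : 'I_mm -> R) (etap : 'I_mp -> R)
    (alpha : 'rV[R]_mm * 'rV[R]_mp) : set (R -> R) :=
  [set u | [/\ C_I 2 u,
      u (-1) = \sum_(i < mm) alpha.1 0 i * u (etam i) &
      u 1 = \sum_(i < mp) alpha.2 0 i * u (etap i)]].

(* The inverse of Delta : X -> C^0[-1, 1], u |-> u''.  Delta is bijective as
   soon as alpha \in A_ 1; the value is irrelevant otherwise. *)
Definition Delta_inv (R : realType) (mm mp : nat)
    (etam : 'I_mm -> R) (etap : 'I_mp -> R)
    (alpha : 'rV[R]_mm * 'rV[R]_mp) (h : R -> R) : R -> R :=
  xget 0 [set u | X_ etam etap alpha u /\
                  {in `[-1, 1], deriv_I (deriv_I u) =1 h}].

Definition K_ (R : realType) (mm mp : nat)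
    (etam : 'I_mm -> R) (etap : 'I_mp -> R)
    (alpha : 'rV[R]_mm * 'rV[R]_mp) (r u : R -> R) : R -> R :=
  - Delta_inv etam etap alpha (r \* u).

(* T_k^nu, with nu = + encoded by false and nu = - by true. *)
Definition T_ (R : realType) (mm mp : nat)
    (etam : 'I_mm -> R) (etap : 'I_mp -> R)
    (alpha : 'rV[R]_mm * 'rV[R]_mp) (k : nat) (nu : bool) : set (R -> R) :=
  [set u | [/\ X_ etam etap alpha u,
      [/\ deriv_I u (-1) != 0, deriv_I u 1 != 0
        & 0 < (-1) ^+ nu * deriv_I u (-1)],
      {in `]-1, 1[, forall x, deriv_I u x = 0 -> deriv_I (deriv_I u) x != 0},
      ([set x | (x \in `]-1, 1[) /\ deriv_I u x = 0] #= `I_k)%card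
    & {in `]-1, 1[ &, forall a b, a < b ->
        deriv_I u a = 0 -> deriv_I u b = 0 ->
        {in `]a, b[, forall x, deriv_I u x != 0} ->
        exists2 z, z \in `]a, b[ & u z = 0}]].

Definition eigenfunction (R : realType) (mm mp : nat)
    (etam : 'I_mm -> R) (etap : 'I_mp -> R)
    (alpha : 'rV[R]_mm * 'rV[R]_mp) (r : R -> R) (lambda : R) :
    set (R -> R) :=
  [set u | [/\ X_ etam etap alpha u, nontrivial_I u &
      {in `[-1, 1], forall x, - deriv_I (deriv_I u) x = lambda * r x * u x}]].

Definition eigenvalue (R : realType) (mm mp : nat)
    (etam : 'I_mm -> R) (etap : 'I_mp -> R)
    (alpha : 'rV[R]_mm * 'rV[R]_mp) (r : R -> R) (lambda : R) : Prop :=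
  exists u, eigenfunction etam etap alpha r lambda u.

(* The union over l >= 1 of the null spaces of (I_Y - lambda K_r)^l, with
   Y = C^0[-1, 1]. *)
Definition gen_null_space (R : realType) (mm mp : nat)
    (etam : 'I_mm -> R) (etap : 'I_mp -> R)
    (alpha : 'rV[R]_mm * 'rV[R]_mp) (r : R -> R) (lambda : R) :
    set (R -> R) :=
  [set u | C_I 0 u /\ exists2 l, (0 < l)%N &
      {in `[-1, 1], forall x,
        iter l (fun v => v - lambda *: K_ etam etap alpha r v) u x = 0}].

(* The subset V of C^0[-1, 1] is a line: V = R phi for some phi which does not
   vanish identically on [-1, 1]. *)
Definition dim1 (R : realType) (V : set (R -> R)) : Prop :=
  exists phi, [/\ C_I 0 phi, nontrivial_I phi & forall u, C_I 0 u ->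
    (V u <-> exists c, {in `[-1, 1], forall x, u x = c * phi x})].

Definition simple_eigenvalue (R : realType) (mm mp : nat)
    (etam : 'I_mm -> R) (etap : 'I_mp -> R)
    (alpha : 'rV[R]_mm * 'rV[R]_mp) (r : R -> R) (lambda : R) : Prop :=
  eigenvalue etam etap alpha r lambda /\
  dim1 (gen_null_space etam etap alpha r lambda).

(* The eigenvalues are lambda k for k >= 1, in increasing order; lambda 0 is
   unconstrained. *)
Definition is_spectrum (R : realType) (mm mp : nat)
    (etam : 'I_mm -> R) (etap : 'I_mp -> R)
    (alpha : 'rV[R]_mm * 'rV[R]_mp) (r : R -> R) (lambda : nat -> R) : Prop :=
  [/\ forall mu, eigenvalue etam etap alpha r mu <->
        exists2 k, (0 < k)%N & mu = lambda k,
      forall k, (0 < k)%N -> 0 < lambda k < lambda k.+1,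
      forall k, (0 < k)%N -> simple_eigenvalue etam etap alpha r (lambda k),
      lambda k @[k --> \oo] --> +oo
    & forall k, (0 < k)%N -> exists2 u,
        eigenfunction etam etap alpha r (lambda k) u &
        T_ etam etap alpha k false u].

(* gamma is an admissible choice of the constant gamma(r). *)
Definition spectral_bound (R : realType) (mm mp : nat)
    (etam : 'I_mm -> R) (etap : 'I_mp -> R) (r : R -> R) (gamma : R) : Prop :=
  0 < gamma <= 1 /\
  forall alpha, A_ gamma alpha ->
    exists lambda, is_spectrum etam etap alpha r lambda.

(* Main.v *)
Require Import Defs.
From HB Require Import structures.
From mathcomp Require Import all_boot all_order all_algebra.
From mathcomp Require Import all_classical all_reals all_analysis.
From mathcomp Require Import ring lra.
Set Implicit Arguments.
Unset Strict Implicit.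
Unset Printing Implicit Defensive.
Import Order.TTheory GRing.Theory Num.Theory.
Import numFieldNormedType.Exports.
Local Open Scope classical_set_scope.
Local Open Scope ring_scope.

(** Write f(x, xi) = r(x) xi + g(x, xi) with r = rinf, so that g(x, xi) is
    o(|xi|) uniformly in x.  As no eigenvalue equals 1, the linear problem
    -u'' = r u has only the trivial solution in X, and the problem for f is a
    sublinear perturbation of an invertible linear one.  A degree or Schauder
    argument in C^0[-1, 1] would conclude at once; here the perturbation
    argument is made for finite differences, where it is two-dimensional, and
    only the passage to the limit is infinite-dimensional.

    On the grid with N steps of length h = 2 / N, replace u'' by second
    differences and the values at the points eta by the values at nearby grid
    points.  A solution of the difference equation is determined by its first
    two values (a, b), so the discrete problem is the search for a zero of the
    continuous map of the plane sending (a, b) to the two boundary defects.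
    This map differs from the one for the linear equation by o(|(a, b)|).  If
    the linear one is injective, composing with its inverse gives the identity
    plus a sublinear map, which has a zero by the Poincare-Miranda theorem
    ([poincare_miranda], [discrete_existence]).  That theorem follows in the
    plane from a parity count on a chessboard ([grid_crossing]).

    The link with the differential equation is [discrete_limit]: bounded
    approximate solutions of the discrete problems, on finer and finer grids,
    converge to a C^2 solution of the continuous problem.  The second
    differences are bounded, hence so are the first ones, so the grid functions
    and their difference quotients are uniformly Lipschitz; limits of their
    values are taken along an ultrafilter, and the difference equation passes
    to the limit as a statement on derivatives, without any integral.

    This is used twice.  For the linear equation it gives, by contradiction and
    normalization, the uniform estimate |v| <= c D for grid functions with
    residual D on fine grids ([discrete_stability]); with D = 0 this is the
    injectivity needed above, and with D = o(|v|) it bounds the discrete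
    solutions of the nonlinear problem independently of the grid
    ([a_priori_bound]).  These solutions then converge to the desired u. *)

(** * Zeros of continuous maps of the plane *)

(** Sperner's parity argument.  Label a vertex 0 where a fails, and 1 or 2
    according to b where a holds, and count mod 2 the edges with labels 1 and
    2.  A cell on which a or b is constant has an even number of them.  If all
    cells are of this kind, the parity for the vertical edges is the same in
    all columns, since the bottom side has no label 2 and the top side no
    label 1.  But it is even in the left column, where a fails, and odd in the
    right one, where a holds and b changes. *)
Lemma grid_crossing (n : nat) (a b : nat -> nat -> bool) :
  (forall j, (j <= n)%N -> ~~ a 0 j) -> (forall j, (j <= n)%N -> a n j) ->
  (forall i, (i <= n)%N -> ~~ b i 0) -> (forall i, (i <= n)%N -> b i n) ->
  exists i j, [/\ (i < n)%N, (j < n)%N &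
    exists p q s t : bool * bool,
      [/\ ~~ a (i + p.1) (j + p.2), a (i + q.1) (j + q.2),
          ~~ b (i + s.1) (j + s.2) & b (i + t.1) (j + t.2)]]%N.
Proof.
move=> a0 an b0 bn; apply: contrapT => noX.
(* the edge from (i, j) to (i', j') has labels 1 and 2 *)
pose e i j i' j' := [&& a i j, a i' j' & b i j (+) b i' j'].
have cell i j : (i < n)%N -> (j < n)%N ->
    e i j i j.+1 (+) e i.+1 j i.+1 j.+1 = e i j i.+1 j (+) e i j.+1 i.+1 j.+1.
  move=> iN jN; rewrite /e.
  have pick (c : nat -> nat -> bool) :
      (forall p q : bool * bool,
         c (i + p.1) (j + p.2) = c (i + q.1) (j + q.2))%N \/
      exists p q : bool * bool,
        (~~ c (i + p.1) (j + p.2) /\ c (i + q.1) (j + q.2))%N.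
    case: (pselect (exists p q : bool * bool,
        (~~ c (i + p.1) (j + p.2) /\ c (i + q.1) (j + q.2))%N)); first by right.
    move=> nc; left => p q; apply/idP/idP => h; apply: contrapT => /negP h'.
      by apply: nc; exists q, p.
    by apply: nc; exists p, q.
  have corner (c : nat -> nat -> bool) :
      (forall p q : bool * bool,
         c (i + p.1) (j + p.2) = c (i + q.1) (j + q.2))%N ->
      [/\ c i j.+1 = c i j, c i.+1 j = c i j & c i.+1 j.+1 = c i j].
    move=> cc; have := (cc (false, true) (false, false),
      cc (true, false) (false, false), cc (true, true) (false, false)).
    by rewrite /= !addn0 !addn1 => -[[-> ->] ->].
  case: (pick a) => [/corner[-> -> ->]|[p [q [ap aq]]]].
    case: (a i j) => //=.
    by case: (b i j) (b i j.+1) (b i.+1 j) (b i.+1 j.+1) => [] [] [] [].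
  case: (pick b) => [/corner[-> -> ->]|[s [t [bs bt]]]].
    by rewrite addbb !andbF.
  by case: noX; exists i, j; split=> //; exists p, q, s, t.
pose S m i := \big[addb/false]_(0 <= j < m) e i j i j.+1.
(* summing over the cells of a strip, the inner horizontal edges cancel *)
have strip m i : (i < n)%N -> (m <= n)%N ->
    S m i (+) S m i.+1 = e i 0 i.+1 0 (+) e i m i.+1 m.
  move=> iN; elim: m => [_|m IH mn]; first by rewrite /S !big_nil !addbb.
  rewrite /S !big_nat_recr //= addbACA -/(S m i) -/(S m i.+1) IH 1?ltnW //.
  by rewrite cell // addbA addbK.
have Sconst i : (i <= n)%N -> S n i = S n 0.
  elim: i => [//|i IH] iN; rewrite -IH 1?ltnW //; apply/esym/eqP.
  rewrite -negb_add strip // /e (bn i (ltnW iN)) (bn i.+1 iN).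
  by rewrite (negPf (b0 i (ltnW iN))) (negPf (b0 i.+1 iN)) /= !andbF.
have S0 : S n 0 = false.
  rewrite /S big_nat_cond big1 // => j /andP[/andP[_ jn] _].
  by rewrite /e (negPf (a0 j (ltnW jn))).
have Sn m : (m <= n)%N -> S m n = b n 0 (+) b n m.
  elim: m => [_|m IH mn]; first by rewrite /S big_nil addbb.
  rewrite /S big_nat_recr //= -/(S m n) IH 1?ltnW // /e !an ?(ltnW mn) //=.
  by rewrite addbA addbK.
by have := Sconst n (leqnn n); rewrite S0 Sn // bn // (negPf (b0 n _)).
Qed.

(** An ultrafilter on nat finer than the neighbourhoods of infinity makes
    every bounded sequence converge, which replaces all extractions of
    subsequences below. *)
Lemma free_ultrafilter :
  exists U : set_system nat, UltraFilter U /\ forall n, U [set k | (n <= k)%N].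
Proof.
have [U [UU sU]] := ultraFilterLemma (F := \oo) _.
by exists U; split=> // n; apply: sU; exact: nbhs_infty_ge.
Qed.

Lemma ultra_limit (R : realType) (U : set_system nat) (UU : UltraFilter U)
    (s : nat -> R) (a b : R) : (forall n, a <= s n <= b) ->
  exists2 l, a <= l <= b &
    forall e : R, 0 < e -> \forall n \near U, `|s n - l| <= e.
Proof.
move=> sab; have [|l [/= lab cl]] := @segment_compact R a b (s @ U) _.
  suff: U [set n | s n \in `[a, b]] by [].
  by apply: filterE => n /=; rewrite in_itv /=; exact: sab.
exists l; first by rewrite in_itv in lab.
move=> e e0; have [//|Ufar] := in_ultra_setVsetC [set n | `|s n - l| <= e] UU.
have [y [[n far <-]]] := cl (s @` ~` [set n | `|s n - l| <= e]) (ball l e)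
  (filterS (fun n far => ex_intro2 _ _ n far erefl) Ufar) (nbhsx_ballx l e e0).
by rewrite /ball /= distrC => /ltW.
Qed.

(** On finer and finer grids, some cell has corners of both signs for G and
    for H.  These cells accumulate at a point of the square, where by
    continuity neither G nor H can be nonzero. *)
Lemma poincare_miranda (R : realType) (G H : R * R -> R) :
  continuous G -> continuous H ->
  (forall t : R, -1 <= t <= 1 -> G (-1, t) < 0 < G (1, t)) ->
  (forall s : R, -1 <= s <= 1 -> H (s, -1) < 0 < H (s, 1)) ->
  exists z, G z = 0 /\ H z = 0.
Proof.
move=> Gc Hc Gbd Hbd; have [U [UU Uoo]] := free_ultrafilter.
pose pt n i : R := -1 + (2 / n.+1%:R) * i%:R.
have pt0 n : pt n 0 = -1 by rewrite /pt mulr0 addr0.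
have ptn n : pt n n.+1 = 1 by rewrite /pt divfK ?pnatr_eq0 //; ring.
have pt_itv n i : (i <= n.+1)%N -> -1 <= pt n i <= 1.
  move=> iN; rewrite -{2}(ptn n) /pt lerDl lerD2l.
  by rewrite ler_pM2l ?divr_gt0 ?ltr0n // ler_nat iN mulr_ge0 ?divr_ge0.
pose a n i j := 0 <= G (pt n i, pt n j).
pose b n i j := 0 <= H (pt n i, pt n j).
have cross n : exists ij : nat * nat, [/\ (ij.1 <= n)%N, (ij.2 <= n)%N &
    exists p q s t : bool * bool,
      [/\ ~~ a n (ij.1 + p.1) (ij.2 + p.2), a n (ij.1 + q.1) (ij.2 + q.2),
       ~~ b n (ij.1 + s.1) (ij.2 + s.2) & b n (ij.1 + t.1) (ij.2 + t.2)]]%N.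
  have [||||i [j [iN jN X]]] := @grid_crossing n.+1 (a n) (b n); last first.
  - by exists (i, j).
  - by move=> i iN; rewrite /b ptn ltW //; case/andP: (Hbd _ (pt_itv n i iN)).
  - by move=> i iN; rewrite /b pt0 -ltNge; case/andP: (Hbd _ (pt_itv n i iN)).
  - by move=> i iN; rewrite /a ptn ltW //; case/andP: (Gbd _ (pt_itv n i iN)).
  - by move=> i iN; rewrite /a pt0 -ltNge; case/andP: (Gbd _ (pt_itv n i iN)).
have [c cP] := choice cross.
have [n|x _ cx] := @ultra_limit R U UU (fun n => pt n (c n).1) (-1) 1.
  by apply: pt_itv; have [i1 _ _] := cP n; exact: leqW.
have [n|y _ cy] := @ultra_limit R U UU (fun n => pt n (c n).2) (-1) 1.
  by apply: pt_itv; have [_ i1 _] := cP n; exact: leqW.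
(* all four corners of the n-th crossing cell tend to (x, y) *)
have near_xy (P : set (R * R)) : nbhs (x, y) P -> exists n,
    forall p : bool * bool, P (pt n ((c n).1 + p.1), pt n ((c n).2 + p.2))%N.
  move=> /nbhs_ballP[e /= e0 eP].
  have e40 : 0 < e / 4 by rewrite divr_gt0.
  have small : \forall n \near U, 2 / n.+1%:R <= e / 4 :> R.
    apply: (filterS _ (Uoo (Num.truncn (8 / e)))) => n /= nN.
    rewrite ler_pdivrMr ?ltr0n // mulrC -ler_pdivrMr //.
    have -> : 2 / (e / 4) = 8 / e by field; rewrite gt_eqF.
    by apply/ltW/(lt_le_trans (truncnS_gt _)); rewrite ler_nat ltnS.
  near U => n; exists n => p; apply: eP.
  have [dx dy dn] : [/\ `|pt n (c n).1 - x| <= e / 4,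
      `|pt n (c n).2 - y| <= e / 4 & 2 / n.+1%:R <= e / 4 :> R].
    by split; near: n; [exact: cx | exact: cy | exact: small].
  have close i (o : bool) z : `|pt n i - z| <= e / 4 ->
      `|z - pt n (i + o)%N| < e.
    have dn0 : 0 <= 2 / n.+1%:R :> R by rewrite divr_ge0.
    rewrite /pt natrD mulrDr addrA -/(pt n i) distrC.
    move: dn dn0 (pt n i); set h := _ / _ => dn dn0 t; rewrite ler_norml.
    move=> /andP[h1 h2]; rewrite ltr_norml.
    by case: o; rewrite ?mulr1 ?mulr0; apply/andP; split; lra.
  by split; exact: close.
have zero (K : R * R -> R) : continuous K -> (forall n, exists p q : bool * bool,
    ~~ (0 <= K (pt n ((c n).1 + p.1)%N, pt n ((c n).2 + p.2)%N)) /\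
    0 <= K (pt n ((c n).1 + q.1)%N, pt n ((c n).2 + q.2)%N)) -> K (x, y) = 0.
  move=> Kc K0; apply/eqP; rewrite eq_le; apply/andP; split; rewrite leNgt;
    apply/negP => Kxy.
    have [n nP] := near_xy _ (cvgr_gt _ (Kc (x, y)) _ Kxy).
    by have [p [q [/negP]]] := K0 n; case; apply/ltW/nP.
  have [n nP] := near_xy _ (cvgr_lt _ (Kc (x, y)) _ Kxy).
  by have [p [q [_ /le_lt_trans/(_ (nP q))]]] := K0 n; rewrite ltxx.
exists (x, y); split; apply: zero => // n.
  by have [_ _ [p [q [s [t [ap aq bs bt]]]]]] := cP n; exists p, q.
by have [_ _ [p [q [s [t [ap aq bs bt]]]]]] := cP n; exists s, t.
Unshelve. all: by end_near.
Qed.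

(** * Grid functions and their limits *)

Definition mesh (R : realType) (N : nat) : R := 2 / N%:R.

Definition node (R : realType) (N i : nat) : R := -1 + mesh R N * i%:R.

Definition index_below (R : realType) (N : nat) (x : R) : nat :=
  Num.truncn ((x + 1) / mesh R N).

Lemma mesh_gt0 (R : realType) (N : nat) : (0 < N)%N -> 0 < mesh R N.
Proof. by move=> N0; rewrite divr_gt0 ?ltr0n. Qed.

Lemma node0 (R : realType) (N : nat) : node R N 0 = -1.
Proof. by rewrite /node mulr0 addr0. Qed.

Lemma nodeN (R : realType) (N : nat) : (0 < N)%N -> node R N N = 1.
Proof.
by move=> N0; rewrite /node /mesh divfK ?pnatr_eq0 -?lt0n //; ring.
Qed.

Lemma nodeS (R : realType) (N i : nat) :
  node R N i.+1 = node R N i + mesh R N.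
Proof. by rewrite /node -natr1; ring. Qed.

Lemma node_le (R : realType) (N i j : nat) :
  (i <= j)%N -> node R N i <= node R N j.
Proof.
by move=> ij; rewrite lerD2l ler_wpM2l ?divr_ge0 // ler_nat.
Qed.

Lemma node_itv (R : realType) (N i : nat) : (0 < N)%N -> (i <= N)%N ->
  -1 <= node R N i <= 1.
Proof.
move=> N0 iN; apply/andP; split; first by rewrite -(node0 R N) node_le.
by apply: le_trans (node_le _ _ iN) _; rewrite nodeN.
Qed.

Lemma index_below_le (R : realType) (N : nat) (x : R) : (0 < N)%N -> -1 <= x <= 1 ->
  (index_below N x <= N)%N.
Proof.
move=> N0 /andP[x1 x2]; rewrite /index_below truncn_le_nat ltr_pdivrMr ?mesh_gt0 //.
have : mesh R N * N%:R = 2 by rewrite /mesh divfK ?pnatr_eq0 -?lt0n.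
have := mesh_gt0 R N0; rewrite -natr1; nra.
Qed.

Lemma node_index_below (R : realType) (N : nat) (x : R) : (0 < N)%N -> -1 <= x <= 1 ->
  `|node R N (index_below N x) - x| <= mesh R N.
Proof.
move=> N0 /andP[x1 x2]; have h0 := mesh_gt0 R N0.
have /truncn_itv/andP[] : 0 <= (x + 1) / mesh R N by apply: divr_ge0; [lra | exact: ltW].
rewrite -/(index_below N x) ler_pdivlMr // ltr_pdivrMr // -natr1 /node => a b.
by rewrite ler_norml; apply/andP; split; nra.
Qed.

(** Discrete mean value inequality: the increments of s are compared with
    those of the function of constant slope c. *)
Lemma increment_le (R : realType) (N : nat) (s : nat -> R) (c e : R) (i j : nat) :
  (i <= j)%N ->
  (forall l, (i <= l < j)%N -> `|s l.+1 - s l - c * mesh R N| <= e * mesh R N) ->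
  `|s j - s i - c * (node R N j - node R N i)| <= e * (node R N j - node R N i).
Proof.
move=> ij; rewrite -(subnKC ij); elim: (j - i)%N => [_|m IH sl].
  by rewrite addn0 !subrr !mulr0 subr0 normr0.
rewrite addnS nodeS; have h1 := sl (i + m)%N.
have {}h1 : `|s (i + m).+1 - s (i + m)%N - c * mesh R N| <= e * mesh R N.
  by apply: h1; rewrite leq_addr addnS ltnSn.
have /IH h2 : forall l, (i <= l < i + m)%N ->
    `|s l.+1 - s l - c * mesh R N| <= e * mesh R N.
  by move=> l /andP[il lm]; apply: sl; rewrite il addnS ltnW.
rewrite (_ : s (i + m).+1 - s i - _ = s (i + m).+1 - s (i + m)%N - c * mesh R N +
  (s (i + m)%N - s i - c * (node R N (i + m) - node R N i))); last by ring.
by apply: le_trans (ler_normD _ _) _; lra.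
Qed.

Lemma increment_abs (R : realType) (N : nat) (s : nat -> R) (c e : R)
    (i j : nat) :
  (forall l, (minn i j <= l < maxn i j)%N ->
    `|s l.+1 - s l - c * mesh R N| <= e * mesh R N) ->
  `|s j - s i - c * (node R N j - node R N i)| <=
    e * `|node R N j - node R N i|.
Proof.
have [ij|/ltnW ij] := leqP i j => sl.
  by rewrite (ger0_norm (_ : 0 <= node R N j - _)) ?subr_ge0 ?node_le //;
    exact: increment_le.
rewrite distrC (distrC (node R N j)) (ger0_norm (_ : 0 <= node R N i - _));
  last by rewrite subr_ge0 node_le.
rewrite (_ : c * _ - _ = s i - s j - c * (node R N i - node R N j)); last by ring.
exact: increment_le.
Qed.

Section Limits.
Variables (R : realType) (U : set_system nat) (UU : UltraFilter U).
Variables (N : nat -> nat).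
Hypothesis (N0 : forall n, (0 < N n)%N).
Hypothesis (mesh0 : forall e : R, 0 < e ->
  \forall n \near U, mesh R (N n) <= e).

(** Continuous convergence: the grid functions s n tend to c at all grid points
    that tend to x.  Unlike the convergence of the values at one grid point, it
    is stable under composition with continuous functions and under shifts of
    the index. *)
Definition tends (s : nat -> nat -> R) (x c : R) : Prop :=
  forall e, 0 < e -> exists2 d, 0 < d & \forall n \near U,
    forall l, (l <= N n)%N -> `|node R (N n) l - x| <= d -> `|s n l - c| <= e.

Lemma tends_index_below s x c (e : R) : -1 <= x <= 1 -> tends s x c -> 0 < e ->
  \forall n \near U, `|s n (index_below (N n) x) - c| <= e.
Proof.
move=> xI /[apply] -[d d0 sd]; near=> n; have := near sd n; apply=> //.
  exact: index_below_le.
by apply: le_trans (node_index_below _ _) _ => //; near: n; exact: mesh0.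
Unshelve. all: by end_near.
Qed.

(** Compactness of bounded uniformly Lipschitz grid functions, in the manner of
    Arzela and Ascoli: the values next to x converge along the ultrafilter, and
    the Lipschitz bound propagates the limit to all nearby grid points. *)
Lemma tends_lipschitz (s : nat -> nat -> R) (M L x : R) : -1 <= x <= 1 ->
  (forall n l, (l <= N n)%N -> `|s n l| <= M) ->
  (forall n l, (l < N n)%N -> `|s n l.+1 - s n l| <= L * mesh R (N n)) ->
  exists c, tends s x c.
Proof.
move=> xI sM sL.
have [n|c _ sc] := @ultra_limit R U UU (fun n => s n (index_below (N n) x)) (- M) M.
  by rewrite -ler_norml sM // index_below_le.
have L0 : 0 <= L.
  have := le_trans (normr_ge0 _) (sL 0 0 (N0 0)).
  by rewrite pmulr_lge0 // mesh_gt0.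
(* grid points within d of x are within 2 d of the one next to x *)
exists c => e e0; pose d := e / 4 / (L + 1).
have L1 : 0 < L + 1 by rewrite ltr_wpDl.
have d0 : 0 < d by rewrite !divr_gt0.
have Ld : L * d <= e / 4.
  have : d * (L + 1) = e / 4 by rewrite divfK // gt_eqF.
  by rewrite mulrC; lra.
exists d => //; near=> n => l lN ld.
have h1 : `|s n (index_below (N n) x) - c| <= e / 2.
  by near: n; apply: sc; rewrite divr_gt0.
have h2 : `|s n l - s n (index_below (N n) x)| <= L * (2 * d).
  have := @increment_abs R (N n) (s n) 0 L (index_below (N n) x) l.
  rewrite !mul0r subr0 => /(_ _)/le_trans -> //.
    move=> k /andP[_ kl]; rewrite subr0 sL //; apply: leq_trans kl _.
    by rewrite geq_max index_below_le.
  rewrite ler_wpM2l // -(subrKA x) (le_trans (ler_normD _ _)) //.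
  have : `|node R (N n) (index_below (N n) x) - x| <= d.
    by apply: le_trans (node_index_below _ _) _ => //; near: n; exact: mesh0.
  by rewrite distrC; lra.
rewrite -(subrKA (s n (index_below (N n) x))) (le_trans (ler_normD _ _)) //; lra.
Unshelve. all: by end_near.
Qed.

Lemma tends_comp (phi : R -> R -> R) (s : nat -> nat -> R) (x c : R) :
  {for (x, c), continuous (fun p : R * R => phi p.1 p.2)} ->
  tends s x c -> tends (fun n l => phi (node R (N n) l) (s n l)) x (phi x c).
Proof.
move=> phic sc e e0; have /cvgrPdist_le/(_ e e0) := phic.
move=> /nbhs_ballP[d /= d0 dP].
have [d' d'0 sd'] := sc (d / 2) (divr_gt0 d0 (ltr0n _ 2)).
exists (Num.min (d / 2) d'); first by rewrite lt_min d'0 divr_gt0.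
near=> n => l lN; rewrite le_min => /andP[l1 l2].
rewrite distrC; apply: (dP (_, _)); split; rewrite /ball /= distrC.
  by lra.
have : `|s n l - c| <= d / 2 by have := near sd' n; apply.
by lra.
Unshelve. all: by end_near.
Qed.

(** S has derivative c at x relative to [-1, 1], without the division that
    makes [dquot] awkward to estimate. *)
Definition has_deriv_I (S : R -> R) (x c : R) : Prop :=
  forall e, 0 < e -> exists2 d, 0 < d & forall y, -1 <= y <= 1 ->
    `|y - x| <= d -> `|S y - S x - c * (y - x)| <= e * `|y - x|.

(** If the slopes of s tend to c at x, then c is the derivative at x of the
    limit function: by the mean value inequality the increments of s between
    the grid points next to x and y are nearly c times the distance, and this
    passes to the limit for each fixed y. *)
Lemma tends_deriv (s : nat -> nat -> R) (S : R -> R) (x c : R) :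
  (forall y, -1 <= y <= 1 -> tends s y (S y)) -> -1 <= x <= 1 ->
  (forall e, 0 < e -> exists2 d, 0 < d & \forall n \near U,
    forall l, (l < N n)%N -> `|node R (N n) l - x| <= d ->
      `|s n l.+1 - s n l - c * mesh R (N n)| <= e * mesh R (N n)) ->
  has_deriv_I S x c.
Proof.
move=> sS xI slope e e0; have [d d0 sd] := slope e e0.
exists (d / 2); first by rewrite divr_gt0.
move=> y yI yx; apply/ler_addgt0Pr => eta eta0.
(* t bounds the four errors made in replacing x, y, S x and S y by their
   grid analogues; their total effect is at most eta *)
pose t := eta / (2 * (1 + e + `|c|)).
have t0 : 0 < t by rewrite divr_gt0 // mulr_gt0 // ltr_wpDr // addr_gt0.
have tE : 2 * (1 + e + `|c|) * t = eta.
  by rewrite mulrC divfK // gt_eqF // mulr_gt0 // ltr_wpDr // addr_gt0.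
near U => n.
have [hx hy] : `|s n (index_below (N n) x) - S x| <= t /\ `|s n (index_below (N n) y) - S y| <= t.
  by split; near: n; apply: tends_index_below => //; exact: sS.
have [h1 h2] : mesh R (N n) <= t /\ mesh R (N n) <= d / 2.
  by split; near: n; apply: mesh0 => //; rewrite divr_gt0.
have := node_index_below (N0 n) xI; have := node_index_below (N0 n) yI.
have iN := index_below_le (N0 n) xI; have jN := index_below_le (N0 n) yI.
set i := index_below (N n) x in hx iN *; set j := index_below (N n) y in hy jN *.
move=> jy ix.
have step l : (minn i j <= l < maxn i j)%N ->
    `|s n l.+1 - s n l - c * mesh R (N n)| <= e * mesh R (N n).
  move=> /andP[l1 l2]; have := near sd n; apply => //.
    by apply: leq_trans l2 _; rewrite geq_max iN.
  have := node_le R (N n) l1; have := node_le R (N n) (ltnW l2).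
  move: yx ix jy; rewrite !ler_norml => /andP[y1 y2] /andP[i1 i2] /andP[j1 j2].
  by case: leqP => _ k1 k2; apply/andP; split; lra.
have := increment_abs step.
set a := s n j - s n i - _; set b := node R (N n) j - _ => ab.
have Sa : `|S y - S x - c * (y - x) - a| <= 2 * t + `|c| * (2 * t).
  rewrite (_ : _ - a = - (s n j - S y) + (s n i - S x) +
      c * ((node R (N n) j - y) - (node R (N n) i - x))); last by rewrite /a; ring.
  apply: le_trans (ler_normD _ _) _; apply: lerD.
    by apply: le_trans (ler_normD _ _) _; rewrite normrN; lra.
  rewrite normrM ler_wpM2l // (le_trans (ler_normB _ _)) //; lra.
have bb : `|b| <= `|y - x| + 2 * t.
  rewrite (_ : b = (y - x) + ((node R (N n) j - y) - (node R (N n) i - x)));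
    last by rewrite /b; ring.
  apply: le_trans (ler_normD _ _) _; rewrite lerD2l.
  by apply: le_trans (ler_normB _ _) _; lra.
rewrite -(subrK a (S y - _ - _)); apply: le_trans (ler_normD _ _) _.
have : e * `|b| <= e * (`|y - x| + 2 * t) by rewrite ler_pM2l.
by rewrite -tE; lra.
Unshelve. all: by end_near.
Qed.

End Limits.

(** * Differentiability on [-1, 1] *)

Lemma itvI (R : realType) (x : R) : (x \in `[-1, 1]) = (-1 <= x <= 1).
Proof. by rewrite in_itv. Qed.

(** Every point of [-1, 1], the end points included, is an accumulation point
    of [-1, 1]; hence limits of difference quotients are unique. *)
Lemma dquot_filter_proper (R : realType) (x : R) : -1 <= x <= 1 ->
  ProperFilter (within `[-1, 1] x^').
Proof.
move=> /andP[x1 x2]; apply: Build_ProperFilter_ex => P.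
rewrite /within /= /dnbhs /= => /nbhs_ballP[e /= e0 eP].
pose t := Num.min (e / 2) 1.
have t0 : 0 < t by rewrite lt_min ltr01 divr_gt0.
have [te t1] : t <= e / 2 /\ t <= 1 by rewrite /t !ge_min !lexx orbT.
have [x0|x0] := leP x 0.
  exists (x + t); apply: eP; rewrite /ball /=.
  - by rewrite ltr_norml; apply/andP; split; lra.
  - by apply/eqP; lra.
  - by rewrite in_itv /=; apply/andP; split; lra.
exists (x - t); apply: eP; rewrite /ball /=.
- by rewrite ltr_norml; apply/andP; split; lra.
- by apply/eqP; lra.
- by rewrite in_itv /=; apply/andP; split; lra.
Qed.

Lemma near_dist (R : realType) (x d : R) : 0 < d ->
  \forall y \near x, `|x - y| <= d.
Proof. by move=> d0; have /cvgrPdist_le/(_ d d0) := @cvg_id _ (nbhs x). Qed.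

Lemma has_deriv_I_dquot (R : realType) (S : R -> R) (x c : R) :
  has_deriv_I S x c -> dquot S x --> c.
Proof.
move=> Sx; apply/cvgrPdist_le => e e0; have [d d0 dS] := Sx e e0.
rewrite near_withinE; near=> y => yI.
have yx : y != x by near: y; exact: nbhs_dnbhs_neq.
have yx0 : 0 < `|y - x| by rewrite normr_gt0 subr_eq0.
rewrite distrC (_ : _ - c = (S y - S x - c * (y - x)) / (y - x)); last first.
  by rewrite [RHS]mulrBl mulfK // subr_eq0.
rewrite normf_div ler_pdivrMr //; apply: dS; first by rewrite -itvI.
rewrite distrC; near: y; apply: nbhs_dnbhs.
exact: near_dist.
Unshelve. all: by end_near.
Qed.

Lemma has_deriv_I_deriv (R : realType) (S : R -> R) (x c : R) : -1 <= x <= 1 ->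
  has_deriv_I S x c -> cvg (dquot S x) /\ deriv_I S x = c.
Proof.
move=> xI Sx; have := has_deriv_I_dquot Sx.
have := dquot_filter_proper xI => FF dS; split; first by apply/cvg_ex; exists c.
exact: cvg_lim.
Qed.

Lemma has_deriv_I_eq (R : realType) (S T : R -> R) (x c : R) : -1 <= x <= 1 ->
  (forall y, -1 <= y <= 1 -> S y = T y) ->
  has_deriv_I S x c -> has_deriv_I T x c.
Proof.
move=> xI ST Sx e e0; have [d d0 dS] := Sx e e0; exists d => // y yI.
by rewrite -!ST //; exact: dS.
Qed.

Lemma has_deriv_I_continuous (R : realType) (S : R -> R) (x c : R) :
  has_deriv_I S x c -> S y @[y --> within `[-1, 1] (nbhs x)] --> S x.
Proof.
move=> Sx; apply/cvgrPdist_le => e e0; have [d d0 dS] := Sx 1 ltr01.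
pose k := 1 + `|c|; have k0 : 0 < k by rewrite ltr_wpDr.
have ek : 0 < e / k by rewrite divr_gt0.
rewrite near_withinE; near=> y => yI; rewrite distrC.
have yx : `|y - x| <= d by rewrite distrC; near: y; exact: near_dist.
have yx' : `|y - x| <= e / k.
  by rewrite distrC; near: y; exact: near_dist.
rewrite -(subrK (c * (y - x)) (S y - S x)); apply: le_trans (ler_normD _ _) _.
have yI' : -1 <= y <= 1 by rewrite -itvI.
rewrite normrM; apply: (@le_trans _ _ (k * `|y - x|)).
  by rewrite /k mulrDl lerD2r; exact: dS.
by rewrite mulrC -ler_pdivlMr.
Unshelve. all: by end_near.
Qed.

Lemma C2_of_has_deriv (R : realType) (u w q : R -> R) :
  (forall x, -1 <= x <= 1 -> has_deriv_I u x (w x)) ->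
  (forall x, -1 <= x <= 1 -> has_deriv_I w x (q x)) ->
  {within `[-1, 1], continuous q} ->
  C_I 2 u /\ (forall x, -1 <= x <= 1 -> deriv_I (deriv_I u) x = q x).
Proof.
move=> uw wq qc.
have du x : -1 <= x <= 1 -> deriv_I u x = w x.
  by move=> xI; have [] := has_deriv_I_deriv xI (uw x xI).
have wq' x : -1 <= x <= 1 -> has_deriv_I (deriv_I u) x (q x).
  by move=> xI; apply: has_deriv_I_eq (wq x xI) => // y yI; rewrite du.
have ddu x : -1 <= x <= 1 -> deriv_I (deriv_I u) x = q x.
  by move=> xI; have [] := has_deriv_I_deriv xI (wq' x xI).
split=> //; split; last split.
- by move=> x; rewrite itvI => xI; have [] := has_deriv_I_deriv xI (uw x xI).
- by move=> x; rewrite itvI => xI; have [] := has_deriv_I_deriv xI (wq' x xI).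
- apply: subspace_eq_continuous qc => x.
  by rewrite inE /= itvI => xI; rewrite /from_subspace /= -[LHS]ddu.
Qed.

Lemma locally_bounded (R : realType) (phi : R -> R -> R) (M : R) :
  continuous (fun p : R * R => phi p.1 p.2) ->
  exists Q, forall x xi, -1 <= x <= 1 -> `|xi| <= M -> `|phi x xi| <= Q.
Proof.
move=> phic.
have : compact ((fun p : R * R => phi p.1 p.2) @` (`[-1, 1] `*` `[-M, M])).
  apply: continuous_compact; first exact: continuous_subspaceT.
  by apply: compact_setX; exact: segment_compact.
move=> /compact_bounded[B [_ /(_ (B + 1))]]; rewrite ltrDl => /(_ ltr01) PB.
exists (B + 1) => x xi xI xiM; apply: PB; exists (x, xi) => //=.
by rewrite !in_itv /= xI -ler_norml.
Qed.

(** Discrete form of the interpolation between a function and its second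
    derivative: w varies by at most 2 Q over [-1, 1], so a large value of w
    anywhere would make v vary by more than 2 M. *)
Lemma slope_le (R : realType) (N : nat) (v : nat -> R) (M Q : R) :
  (0 < N)%N -> (forall i, (i <= N)%N -> `|v i| <= M) ->
  let w i := (v i.+1 - v i) / mesh R N in
  (forall i, (i < N)%N -> `|w i.+1 - w i| <= Q * mesh R N) ->
  forall i, (i <= N)%N -> `|w i| <= M + 2 * Q.
Proof.
move=> N0 vM w wQ i iN; have h0 := mesh_gt0 R N0.
have Q0 : 0 <= Q by have := le_trans (normr_ge0 _) (wQ 0 N0); rewrite pmulr_lge0.
have close j : (j <= N)%N -> `|w j - w i| <= 2 * Q.
  move=> jN; have := @increment_abs R N w 0 Q i j; rewrite !mul0r subr0.
  move=> /(_ _)/le_trans -> //.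
    move=> l /andP[_ lj]; rewrite subr0 wQ //; apply: leq_trans lj _.
    by rewrite geq_max iN.
  rewrite mulrC ler_wpM2r // ler_norml.
  have /andP[a1 a2] := node_itv R N0 iN; have /andP[b1 b2] := node_itv R N0 jN.
  by apply/andP; split; lra.
have := @increment_le R N v (w i) (2 * Q) 0 N (leq0n _).
rewrite node0 nodeN // => /(_ _)/wrap[].
  move=> l /andP[_ lN].
  rewrite (_ : _ - _ - _ = (w l - w i) * mesh R N); last first.
    by rewrite mulrBl [w l * _]divfK // gt_eqF.
  by rewrite normrM (gtr0_norm h0) ler_pM2r // close // ltnW.
have := vM N (leqnn N); have := vM 0 (leq0n N).
rewrite !ler_norml => /andP[a1 a2] /andP[b1 b2] /andP[c1 c2].
by apply/andP; split; lra.
Qed.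

(** * The discrete boundary value problem and its limit *)

Definition boundary_defect (R : realType) (m : nat) (a : 'rV[R]_m) (eta : 'I_m -> R)
    (N k : nat) (v : nat -> R) : R :=
  v k - \sum_(i < m) a 0 i * v (index_below N (eta i)).

(** v solves the discretization of -u'' = phi(x, u) in X up to D.  The equation
    is also imposed at the last node, with v N.+1 as a fictitious value: then
    the difference quotients of v obey the same bounds on the whole grid. *)
Definition approx_solution (R : realType) (mm mp : nat)
    (etam : 'I_mm -> R) (etap : 'I_mp -> R)
    (alpha : 'rV[R]_mm * 'rV[R]_mp) (phi : R -> R -> R)
    (N : nat) (v : nat -> R) (D : R) : Prop :=
  [/\ forall i, (i < N)%N ->
        `|v i.+2 - 2 * v i.+1 + v i
          + mesh R N ^+ 2 * phi (node R N i.+1) (v i.+1)| <= mesh R N ^+ 2 * D,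
      `|boundary_defect alpha.1 etam N 0 v| <= D &
      `|boundary_defect alpha.2 etap N N v| <= D].

(** Limits of discrete solutions are solutions.  With w n the difference
    quotients of v n, both v n and w n are bounded and uniformly Lipschitz, hence
    converge to functions u and z along an ultrafilter.  The slopes of v n are
    w n and those of w n are - phi(x, v n) up to 1 / (n + 1), so that u' = z and
    z' = - phi(x, u).  The last clause keeps u away from 0 when the v n are
    normalized in the maximum norm. *)
Lemma discrete_limit (R : realType) (mm mp : nat)
    (etam : 'I_mm -> R) (etap : 'I_mp -> R)
    (etam_I : forall i, -1 <= etam i <= 1) (etap_I : forall i, -1 <= etap i <= 1)
    (alpha : 'rV[R]_mm * 'rV[R]_mp)
    (phi : R -> R -> R) (phic : continuous (fun p : R * R => phi p.1 p.2))
    (N : nat -> nat) (NS : forall n, (n < N n)%N)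
    (v : nat -> nat -> R) (M : R)
    (vM : forall n i, (i <= N n)%N -> `|v n i| <= M)
    (vP : forall n, approx_solution etam etap alpha phi (N n) (v n) n.+1%:R^-1) :
  exists2 u, X_ etam etap alpha u /\
      (forall x, -1 <= x <= 1 -> - deriv_I (deriv_I u) x = phi x (u x)) &
      forall c, (forall n, exists2 i, (i <= N n)%N & c <= `|v n i|) ->
        exists2 x, -1 <= x <= 1 & c <= `|u x|.
Proof.
have [U [UU Uoo]] := free_ultrafilter.
have N0 n : (0 < N n)%N by apply: leq_ltn_trans (NS n).
have h0 n : 0 < mesh R (N n) by exact: mesh_gt0.
have invS_small e : 0 < e -> \forall n \near U, n.+1%:R^-1 <= e :> R.
  move=> e0; apply: (filterS _ (Uoo (Num.truncn e^-1))) => n /= nN.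
  rewrite -[leRHS]invrK lef_pV2 ?posrE ?ltr0n ?invr_gt0 //.
  by apply/ltW/(lt_le_trans (truncnS_gt _)); rewrite ler_nat ltnS.
have mesh_small e : 0 < e -> \forall n \near U, mesh R (N n) <= e.
  move=> e0; have := invS_small (e / 2) (divr_gt0 e0 (ltr0n _ 2)).
  apply: filterS => n ne; rewrite /mesh.
  have : (N n)%:R^-1 <= n.+1%:R^-1 :> R.
    by rewrite lef_pV2 ?posrE ?ltr0n // ler_nat.
  by move/le_trans/(_ ne); rewrite ler_pdivlMr // mulrC.
have [Q PQ] := locally_bounded M phic.
pose w n i := (v n i.+1 - v n i) / mesh R (N n).
have wE n l : v n l.+1 - v n l = w n l * mesh R (N n).
  by rewrite /w divfK // gt_eqF.
have w_slope n l : (l < N n)%N ->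
    `|w n l.+1 - w n l + phi (node R (N n) l.+1) (v n l.+1) * mesh R (N n)|
      <= n.+1%:R^-1 * mesh R (N n).
  move=> lN; have [/(_ l lN) e _ _] := vP n.
  have E : v n l.+2 - 2 * v n l.+1 + v n l
      + mesh R (N n) ^+ 2 * phi (node R (N n) l.+1) (v n l.+1) =
      (w n l.+1 - w n l + phi (node R (N n) l.+1) (v n l.+1) * mesh R (N n))
      * mesh R (N n).
    by rewrite [RHS]mulrDl [(w _ _ - _) * _]mulrBl -!wE; ring.
  move: e; rewrite E normrM (gtr0_norm (h0 n)) expr2 [leRHS]mulrC.
  by rewrite [leRHS]mulrA ler_pM2r.
have w_lip n l : (l < N n)%N ->
    `|w n l.+1 - w n l| <= (Q + 1) * mesh R (N n).
  move=> lN; have e := w_slope n l lN.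
  have i1 : n.+1%:R^-1 <= 1 :> R by rewrite invf_le1 ?ltr0n // ler1n.
  have pQ : `|phi (node R (N n) l.+1) (v n l.+1) * mesh R (N n)|
      <= Q * mesh R (N n).
    rewrite normrM (gtr0_norm (h0 n)) ler_pM2r //.
    by apply: PQ; [exact: node_itv | exact: vM].
  have i2 : n.+1%:R^-1 * mesh R (N n) <= mesh R (N n).
    by rewrite ler_piMl // ltW.
  rewrite -(addrK (phi (node R (N n) l.+1) (v n l.+1) * mesh R (N n)) (_ - _)).
  apply: le_trans (ler_normB _ _) _; rewrite mulrDl mul1r addrC lerD //.
  exact: le_trans i2.
have wL n l : (l <= N n)%N -> `|w n l| <= M + 2 * (Q + 1).
  exact: (slope_le (N0 n) (vM n) (w_lip n)).
have v_lip n l : (l < N n)%N ->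
    `|v n l.+1 - v n l| <= (M + 2 * (Q + 1)) * mesh R (N n).
  move=> lN; rewrite wE normrM (gtr0_norm (h0 n)) ler_pM2r //.
  by apply: wL; exact: ltnW.
have u_ex x : exists c, -1 <= x <= 1 -> tends U N v x c.
  have [xI|xI] := boolP (-1 <= x <= 1); last by exists 0.
  by have [c cP] := tends_lipschitz UU N0 mesh_small xI vM v_lip; exists c.
have [u uP] := choice u_ex.
have z_ex x : exists c, -1 <= x <= 1 -> tends U N w x c.
  have [xI|xI] := boolP (-1 <= x <= 1); last by exists 0.
  by have [c cP] := tends_lipschitz UU N0 mesh_small xI wL w_lip; exists c.
have [z zP] := choice z_ex.
have uz x : -1 <= x <= 1 -> has_deriv_I u x (z x).
  move=> xI; apply: (tends_deriv UU N0 mesh_small uP) => // e e0.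
  have [d d0 dP] := zP x xI e e0; exists d => //; apply: filterS dP => n dP l lN ld.
  rewrite wE -mulrBl normrM (gtr0_norm (h0 n)) ler_pM2r //.
  by apply: dP => //; exact: ltnW.
have zq x : -1 <= x <= 1 -> has_deriv_I z x (- phi x (u x)).
  move=> xI; apply: (tends_deriv UU N0 mesh_small zP) => // e e0.
  have e20 : 0 < e / 2 by rewrite divr_gt0.
  have [d d0 dP] := tends_comp UU (phic (x, u x)) (uP x xI) e20.
  exists (d / 2); first by rewrite divr_gt0.
  near=> n => l lN ld; have := w_slope n l lN.
  have i1 : n.+1%:R^-1 <= e / 2 :> R by near: n; exact: invS_small.
  have : `|phi (node R (N n) l.+1) (v n l.+1) - phi x (u x)| <= e / 2.
    have := near dP n; apply => //.
    have hd : mesh R (N n) <= d / 2 by near: n; apply: mesh_small; rewrite divr_gt0.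
    have := h0 n; move: ld; rewrite nodeS !ler_norml => /andP[a1 a2] hn.
    by apply/andP; split; lra.
  move=> pe ws; rewrite (_ : _ - _ = (w n l.+1 - w n l
      + phi (node R (N n) l.+1) (v n l.+1) * mesh R (N n))
      - (phi (node R (N n) l.+1) (v n l.+1) - phi x (u x)) * mesh R (N n));
    last by ring.
  apply: le_trans (ler_normB _ _) _; rewrite (splitr e) [leRHS]mulrDl lerD //.
    by apply: le_trans ws _; rewrite ler_pM2r.
  by rewrite normrM (gtr0_norm (h0 n)) ler_pM2r.
have qc : {within `[-1, 1], continuous (fun x => - phi x (u x))}.
  apply/subspace_continuousP => x /=; rewrite itvI => xI.
  apply: cvgN; apply: (@continuous2_cvg _ _ _ _ (within `[-1, 1] (nbhs x)) _
    idfun u phi x (u x) (phic (x, u x))); first exact: cvg_within.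
  exact: (has_deriv_I_continuous (uz x xI)).
have [uC2 ddu] := C2_of_has_deriv uz zq qc.
have cvgU (s : nat -> R) c : (forall e, 0 < e -> \forall n \near U, `|s n - c| <= e) ->
    s @ U --> c.
  move=> sc; apply/cvgrPdist_le => e e0.
  by apply: filterS (sc e e0) => n; rewrite distrC.
have bc m (a : 'rV[R]_m) (eta : 'I_m -> R) (k : nat -> nat) x :
    -1 <= x <= 1 -> (forall n, (k n <= N n)%N /\ node R (N n) (k n) = x) ->
    (forall i, -1 <= eta i <= 1) ->
    (forall n, `|v n (k n) - \sum_(i < m) a 0 i * v n (index_below (N n) (eta i))| <=
      n.+1%:R^-1) -> u x = \sum_(i < m) a 0 i * u (eta i).
  move=> xI kx etaI defect; apply/eqP; rewrite -subr_eq0; apply/eqP.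
  (* the discrete defects converge to the defect of u, and to 0 *)
  have c1 : v n (k n) - \sum_(i < m) a 0 i * v n (index_below (N n) (eta i)) @[n --> U]
      --> u x - \sum_(i < m) a 0 i * u (eta i).
    apply: cvgB.
      apply: cvgU => e e0; have [d d0] := uP x xI e e0; apply: filterS => n.
      have [kN kn] := kx n; apply => //; rewrite kn subrr normr0; exact: ltW.
    apply: cvg_big => [|i _]; [exact: add_continuous | apply: cvgMl_tmp].
    apply: cvgU => e e0.
    exact: (tends_index_below UU N0 mesh_small (etaI i) (uP _ (etaI i)) e0).
  apply: (norm_cvg_unique c1) => /=; apply: cvgU => e e0.
  apply: filterS (invS_small e e0) => n; rewrite subr0; exact: le_trans.
exists u.
  split; last by move=> x xI; rewrite ddu // opprK.
  split=> //.
    apply: (bc _ _ _ (fun=> 0%N)) => //.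
    - by apply/andP; split; lra.
    - by move=> n; rewrite node0.
    - by move=> n; have [] := vP n.
  apply: (bc _ _ _ N) => //.
  - by apply/andP; split; lra.
  - by move=> n; rewrite nodeN.
  - by move=> n; have [] := vP n.
move=> c cv.
have [k kP] := choice (P := fun n i => (i <= N n)%N /\ c <= `|v n i|)
  (fun n => let: ex_intro2 i a b := cv n in ex_intro _ i (conj a b)).
have [n|x xI xP] := @ultra_limit R U UU (fun n => node R (N n) (k n)) (-1) 1.
  by apply: node_itv => //; have [] := kP n.
exists x => //; apply/ler_addgt0Pr => e e0.
have [d d0 dP] := uP x xI e e0; near U => n.
have [kN ck] := kP n; apply: le_trans ck _.
have : `|v n (k n) - u x| <= e.
  by have := near dP n; apply => //; near: n; exact: xP.
by move=> vu; rewrite -[v n _](subrK (u x)) addrC (le_trans (ler_normD _ _)) // lerD2l.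
Unshelve. all: by end_near.
Qed.

(** * Stability of the linear discrete problem *)

Lemma eq_boundary_defect (R : realType) (m : nat) (a : 'rV[R]_m) (eta : 'I_m -> R)
    (N k : nat) (v w : nat -> R) :
  v =1 w -> boundary_defect a eta N k v = boundary_defect a eta N k w.
Proof.
move=> vw; rewrite /boundary_defect vw; congr (_ - _).
by apply: eq_bigr => j _; rewrite vw.
Qed.

Lemma boundary_defectD (R : realType) (m : nat) (a : 'rV[R]_m) (eta : 'I_m -> R)
    (N k : nat) (c : R) (v w : nat -> R) :
  boundary_defect a eta N k (fun i => c * v i + w i) =
    c * boundary_defect a eta N k v + boundary_defect a eta N k w.
Proof.
rewrite /boundary_defect mulrBr mulr_sumr addrACA -opprD -big_split /=; congr (_ - _).
by apply: eq_bigr => i _; rewrite mulrDr mulrCA.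
Qed.

Lemma approx_solutionZ (R : realType) (mm mp : nat)
    (etam : 'I_mm -> R) (etap : 'I_mp -> R) (alpha : 'rV[R]_mm * 'rV[R]_mp)
    (r : R -> R) (N : nat) (v : nat -> R) (D c : R) :
  approx_solution etam etap alpha (fun x xi => r x * xi) N v D ->
  approx_solution etam etap alpha (fun x xi => r x * xi) N
    (fun i => c * v i) (`|c| * D).
Proof.
have bZ m (a : 'rV[R]_m) (eta : 'I_m -> R) k :
    boundary_defect a eta N k (fun i => c * v i) = c * boundary_defect a eta N k v.
  rewrite /boundary_defect mulrBr mulr_sumr; congr (_ - _).
  by apply: eq_bigr => i _; rewrite mulrCA.
move=> [e bm bp]; split; last 2 first.
- by rewrite bZ normrM ler_wpM2l.
- by rewrite bZ normrM ler_wpM2l.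
move=> i iN; have := e i iN; set t := (X in `|X| <= _ -> _) => et.
rewrite (_ : _ + _ = c * t); last by rewrite /t; ring.
by rewrite normrM mulrCA ler_wpM2l.
Qed.

Lemma exists_max (R : realType) (N : nat) (v : nat -> R) :
  exists2 k, (k <= N)%N & forall i, (i <= N)%N -> `|v i| <= `|v k|.
Proof.
elim: N => [|N [k kN kmax]].
  by exists 0%N => // i; rewrite leqn0 => /eqP->.
have [vk|vk] := leP `|v N.+1| `|v k|.
  exists k; first exact: leqW.
  by move=> i; rewrite leq_eqVlt ltnS => /predU1P[->//|]; exact: kmax.
exists N.+1 => // i; rewrite leq_eqVlt ltnS => /predU1P[->//|iN].
by apply: le_trans (kmax i iN) _; exact: ltW.
Qed.

Lemma approx_solution_le (R : realType) (mm mp : nat)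
    (etam : 'I_mm -> R) (etap : 'I_mp -> R) (alpha : 'rV[R]_mm * 'rV[R]_mp)
    (phi : R -> R -> R) (N : nat) (v : nat -> R) (D E : R) : D <= E ->
  approx_solution etam etap alpha phi N v D ->
  approx_solution etam etap alpha phi N v E.
Proof.
move=> DE [e bm bp]; split.
- move=> i iN; apply: le_trans (e i iN) _; rewrite ler_wpM2l //; exact: sqr_ge0.
- exact: le_trans DE.
- exact: le_trans DE.
Qed.

(** Otherwise there are grid functions of maximum norm 1 with residuals tending
    to 0 on finer and finer grids, and their limit would be a nontrivial
    solution of -u'' = r u in X. *)
Lemma discrete_stability (R : realType) (mm mp : nat)
    (etam : 'I_mm -> R) (etap : 'I_mp -> R)
    (etam_I : forall i, -1 <= etam i <= 1) (etap_I : forall i, -1 <= etap i <= 1)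
    (alpha : 'rV[R]_mm * 'rV[R]_mp) (r : R -> R)
    (rc : continuous (fun p : R * R => r p.1 * p.2))
    (noneig : forall u, X_ etam etap alpha u ->
      (forall x, -1 <= x <= 1 -> - deriv_I (deriv_I u) x = r x * u x) ->
      forall x, -1 <= x <= 1 -> u x = 0) :
  exists2 c, 0 < c & exists K, forall N v D, (K < N)%N ->
    approx_solution etam etap alpha (fun x xi => r x * xi) N v D ->
    forall i, (i <= N)%N -> `|v i| <= c * D.
Proof.
apply: contrapT => unstable.
have bad n : exists Nv : nat * (nat -> R), [/\ (n < Nv.1)%N,
    forall i, (i <= Nv.1)%N -> `|Nv.2 i| <= 1,
    exists2 i, (i <= Nv.1)%N & 1 <= `|Nv.2 i| &
    approx_solution etam etap alpha (fun x xi => r x * xi) Nv.1 Nv.2 n.+1%:R^-1].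
  apply: contrapT => nobad; apply: unstable; exists n.+1%:R => //; exists n.
  move=> N v D nN vD i iN; have [k kN kmax] := exists_max N v.
  apply: le_trans (kmax i iN) _; rewrite leNgt; apply/negP => Dk.
  have D0 : 0 <= D by have [_ + _] := vD; apply: le_trans.
  have k0 : 0 < `|v k| by apply: le_lt_trans Dk; rewrite mulr_ge0.
  apply: nobad; exists (N, fun i => `|v k|^-1 * v i); split=> //=.
  - move=> j jN; rewrite normrM normfV normr_id ler_pdivrMl // mulr1.
    exact: kmax.
  - by exists k => //; rewrite normrM normfV normr_id mulVf // gt_eqF.
  apply: approx_solution_le (approx_solutionZ _ vD).
  by rewrite normfV normr_id ler_pdivrMl // ler_pdivlMr ?ltr0n // mulrC ltW.
have [Nv NvP] := choice bad.
have [|||u [uX uE] u1] := @discrete_limit R mm mp etam etap etam_I etap_I alpha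
    (fun x xi => r x * xi) rc (fun n => (Nv n).1) _ (fun n => (Nv n).2) 1.
- by move=> n; have [] := NvP n.
- by move=> n i; have [_ + _ _] := NvP n; apply.
- by move=> n; have [] := NvP n.
have [|x xI] := u1 1; first by move=> n; have [] := NvP n.
by rewrite (noneig u uX uE x xI) normr0 ler10.
Qed.


(** * Sublinear perturbations of the identity *)

(** e(z) = o(|z|) at infinity, and e is bounded on bounded sets. *)
Definition sublinear (R : realType) (e : R * R -> R) : Prop :=
  forall eps : R, 0 < eps -> exists C,
    forall z, `|e z| <= eps * (`|z.1| + `|z.2|) + C.

Lemma sublinear_ext (R : realType) (e1 e2 : R * R -> R) :
  e1 =1 e2 -> sublinear e1 -> sublinear e2.
Proof.
move=> ee s1 e e0; have [C HC] := s1 e e0; exists C => z.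
by rewrite -ee.
Qed.

Lemma sublinear0 (R : realType) : sublinear (fun _ : R * R => 0).
Proof.
move=> e e0; exists 0 => z; rewrite normr0 addr0.
by rewrite mulr_ge0 ?addr_ge0 // ltW.
Qed.

Lemma sublinearD (R : realType) (e1 e2 : R * R -> R) (c : R) :
  sublinear e1 -> sublinear e2 -> sublinear (fun z => c * e1 z + e2 z).
Proof.
move=> s1 s2 e e0; have k0 : 0 < 1 + `|c| by rewrite ltr_wpDr.
have [|C1 H1] := s1 (e / 2 / (1 + `|c|)); first by rewrite !divr_gt0.
have [|C2 H2] := s2 (e / 2); first by rewrite divr_gt0.
exists (`|c| * C1 + C2) => z; apply: le_trans (ler_normD _ _) _; rewrite normrM.
have ek : `|c| * (e / 2 / (1 + `|c|)) <= e / 2.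
  rewrite mulrA ler_pdivrMr // mulrC ler_pM2l ?divr_gt0 //; lra.
have z0 : 0 <= `|z.1| + `|z.2| by rewrite addr_ge0.
have h1 := ler_wpM2l (normr_ge0 c) (H1 z); have h2 := H2 z.
have h3 := ler_wpM2r z0 ek.
by move: h1 h2 h3; rewrite mulrDr mulrA; set x := `|c| * (_ / _) * _; lra.
Qed.

Lemma sublinear_sum (R : realType) (m : nat) (c : 'I_m -> R)
    (e : 'I_m -> R * R -> R) :
  (forall i, sublinear (e i)) -> sublinear (fun z => \sum_(i < m) c i * e i z).
Proof.
move=> es; elim: (index_enum _) => [|i t IH].
  by apply: (sublinear_ext _ (@sublinear0 R)) => z; rewrite big_nil.
apply: (sublinear_ext _ (sublinearD (c i) (es i) IH)) => z.
by rewrite big_cons.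
Qed.

(** On the boundary of a large square, G and H have the signs of the coordinates
    of z. *)
Lemma zero_of_sublinear (R : realType) (G H : R * R -> R) :
  continuous G -> continuous H ->
  sublinear (fun z => G z - z.1) -> sublinear (fun z => H z - z.2) ->
  exists z, G z = 0 /\ H z = 0.
Proof.
move=> Gc Hc Gs Hs; have q0 : 0 < 4^-1 :> R by rewrite invr_gt0.
have [C1 HC1] := Gs _ q0; have [C2 HC2] := Hs _ q0.
(* on the square of half-side M the sublinear parts are at most
   (M + M) / 4 + C1 and (M + M) / 4 + C2, which is less than M *)
pose M := 2 * (1 + `|C1| + `|C2|).
have M0 : 0 < M by rewrite mulr_gt0 // -addrA ltr_wpDr // addr_ge0.
have scale : continuous (fun z : R * R => (M * z.1, M * z.2)).
  move=> z; have c1 : M * y.1 @[y --> z] --> M * z.1.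
    by apply: cvgMl_tmp; exact: cvg_fst.
  have c2 : M * y.2 @[y --> z] --> M * z.2 by apply: cvgMl_tmp; exact: cvg_snd.
  exact: cvg_pair c1 c2.
have bound (K : R * R -> R) C a b : `|C| <= `|C1| + `|C2| ->
    `|K (M * a, M * b) | <= 4^-1 * (`|M * a| + `|M * b|) + C ->
    `|a| <= 1 -> `|b| <= 1 -> `|K (M * a, M * b)| < M.
  move=> CC KC a1 b1; apply: le_lt_trans KC _.
  rewrite (normrM M a) (normrM M b) (gtr0_norm M0).
  have : M * `|a| <= M by rewrite ler_piMr // ltW.
  have : M * `|b| <= M by rewrite ler_piMr // ltW.
  by have := ler_norm C; rewrite /M; lra.
have [|||| z [z1 z2]] := @poincare_miranda R
  (fun z => G (M * z.1, M * z.2)) (fun z => H (M * z.1, M * z.2)).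
- by move=> z; apply: continuous_comp (scale z) (Gc _).
- by move=> z; apply: continuous_comp (scale z) (Hc _).
- move=> t tI; have t1 : `|t| <= 1 by rewrite ler_norml.
  have C12 : `|C1| <= `|C1| + `|C2| by rewrite lerDl.
  have := bound (fun z => G z - z.1) _ _ _ C12 (HC1 (M * -1, M * t)) _ t1; rewrite normrN1
    => /(_ (lexx _)).
  have := bound (fun z => G z - z.1) _ _ _ C12 (HC1 (M * 1, M * t)) _ t1; rewrite normr1
    => /(_ (lexx _)).
  rewrite /= !ltr_norml => /andP[a1 a2] /andP[b1 b2].
  by apply/andP; split; lra.
- move=> t tI; have t1 : `|t| <= 1 by rewrite ler_norml.
  have C12 : `|C2| <= `|C1| + `|C2| by rewrite lerDr.
  have := bound (fun z => H z - z.2) _ _ _ C12 (HC2 (M * t, M * -1)) t1; rewrite normrN1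
    => /(_ (lexx _)).
  have := bound (fun z => H z - z.2) _ _ _ C12 (HC2 (M * t, M * 1)) t1; rewrite normr1
    => /(_ (lexx _)).
  rewrite /= !ltr_norml => /andP[a1 a2] /andP[b1 b2].
  by apply/andP; split; lra.
by exists (M * z.1, M * z.2).
Qed.

(** * Existence for the discrete problem *)

Fixpoint shoot (R : realType) (phi : R -> R -> R) (N : nat) (z : R * R)
    (i : nat) : R * R :=
  if i is j.+1 then
    let p := shoot phi N z j in
    (p.2, 2 * p.2 - p.1 - mesh R N ^+ 2 * phi (node R N j.+1) p.2)
  else z.

(** The solution of the difference equation with first two values z. *)
Definition traj (R : realType) (phi : R -> R -> R) (N : nat) (z : R * R)
    (i : nat) : R := (shoot phi N z i).1.

Lemma trajSS (R : realType) (phi : R -> R -> R) (N : nat) (z : R * R) (i : nat) :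
  traj phi N z i.+2 = 2 * traj phi N z i.+1 - traj phi N z i
    - mesh R N ^+ 2 * phi (node R N i.+1) (traj phi N z i.+1).
Proof. by []. Qed.

Lemma nat_ind2 (P : nat -> Prop) :
  P 0 -> P 1%N -> (forall i, P i -> P i.+1 -> P i.+2) -> forall i, P i.
Proof.
by move=> P0 P1 PS i; suff [] : P i /\ P i.+1 by []; elim: i => [|i []]; split;
  auto.
Qed.

Lemma traj_continuous (R : realType) (phi : R -> R -> R) (N i : nat) :
  continuous (fun p : R * R => phi p.1 p.2) ->
  continuous (fun z => traj phi N z i).
Proof.
move=> phic; elim/nat_ind2: i => [||i c0 c1] z.
- exact: cvg_fst.
- exact: cvg_snd.
rewrite /=; apply: cvgB; first apply: cvgB.
- by apply: cvgMl_tmp; exact: c1.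
- exact: c0.
apply: cvgMl_tmp; apply: (@continuous2_cvg _ _ _ _ (nbhs z) _ (fun=> node R N i.+1)
  (fun y => traj phi N y i.+1) phi _ _ (phic (_, _))); first exact: cvg_cst.
exact: c1.
Qed.

Lemma boundary_defect_continuous (R : realType) (m : nat) (a : 'rV[R]_m)
    (eta : 'I_m -> R) (N k : nat) (v : R * R -> nat -> R) :
  (forall i, continuous (v ^~ i)) ->
  continuous (fun z => boundary_defect a eta N k (v z)).
Proof.
move=> vc z; apply: cvgB; first exact: vc.
apply: cvg_big => [|i _]; first exact: add_continuous.
by apply: cvgMl_tmp; exact: vc.
Qed.

Lemma traj_linear (R : realType) (r : R -> R) (N : nat) (z : R * R) (i : nat) :
  let L := traj (fun x xi => r x * xi) N in
  L z i = z.1 * L (1, 0) i + z.2 * L (0, 1) i.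
Proof.
elim/nat_ind2: i => [||i h0 h1] /=.
- by rewrite /traj /=; ring.
- by rewrite /traj /=; ring.
by rewrite !trajSS h0 h1; ring.
Qed.

(** On a fixed grid, the solution of the nonlinear difference equation remains
    within o(|z|) of the linear one: a step of the recursion adds a linear
    combination of the previous errors and the value of the sublinear part of
    phi at a point of norm O(|z|). *)
Lemma traj_sublinear (R : realType) (phi : R -> R -> R) (r : R -> R) (N i : nat) :
  (forall e, 0 < e -> exists C, forall x xi,
    `|phi x xi - r x * xi| <= e * `|xi| + C) ->
  sublinear (fun z => traj phi N z i - traj (fun x xi => r x * xi) N z i).
Proof.
move=> phir; pose L := traj (fun x xi => r x * xi) N.
elim/nat_ind2: i => [||i s0 s1].
- by apply: (sublinear_ext _ (@sublinear0 R)) => z; rewrite subrr.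
- by apply: (sublinear_ext _ (@sublinear0 R)) => z; rewrite subrr.
have sg : sublinear (fun z => phi (node R N i.+1) (traj phi N z i.+1)
    - r (node R N i.+1) * traj phi N z i.+1).
  move=> e e0; have [C1 H1] := s1 1 ltr01.
  pose B := `|L (1, 0) i.+1| + `|L (0, 1) i.+1|.
  have B0 : 0 < 1 + B by rewrite ltr_wpDr // addr_ge0.
  have eB : 0 < e / (1 + B) by rewrite divr_gt0.
  have [C HC] := phir _ eB.
  exists (e / (1 + B) * C1 + C) => z; apply: le_trans (HC _ _) _.
  rewrite [leRHS]addrA lerD2r.
  have eE : e = e / (1 + B) * (1 + B) by rewrite divfK // gt_eqF.
  rewrite [X in X * _ + _]eE -mulrA -mulrDr.
  rewrite ler_pM2l // -(subrK (L z i.+1) (traj _ _ _ _)).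
  apply: le_trans (ler_normD _ _) _.
  have := H1 z; rewrite -/L.
  have : `|L z i.+1| <= B * (`|z.1| + `|z.2|).
    rewrite /L traj_linear -/L (le_trans (ler_normD _ _)) // !normrM.
    have := mulr_ge0 (normr_ge0 z.1) (normr_ge0 (L (0, 1) i.+1)).
    have := mulr_ge0 (normr_ge0 z.2) (normr_ge0 (L (1, 0) i.+1)).
    by rewrite /B; nra.
  by lra.
have := sublinearD (- mesh R N ^+ 2) sg
  (sublinearD (2 - mesh R N ^+ 2 * r (node R N i.+1)) s1
    (sublinearD (-1) s0 (@sublinear0 R))).
by apply: sublinear_ext => z; rewrite !trajSS; ring.
Qed.

Lemma boundary_defect_sublinear (R : realType) (m : nat) (a : 'rV[R]_m)
    (eta : 'I_m -> R) (N k : nat) (v : R * R -> nat -> R) :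
  (forall i, sublinear (v ^~ i)) ->
  sublinear (fun z => boundary_defect a eta N k (v z)).
Proof.
move=> vs; have := sublinearD (-1)
  (sublinear_sum (fun i => a 0 i) (fun i => vs (index_below N (eta i)))) (vs k).
by apply: sublinear_ext => z; rewrite mulN1r addrC.
Qed.

(** Shooting.  The two boundary defects, as functions of the first two values,
    form an invertible linear map plus a sublinear one. *)
Lemma discrete_existence (R : realType) (mm mp : nat)
    (etam : 'I_mm -> R) (etap : 'I_mp -> R)
    (alpha : 'rV[R]_mm * 'rV[R]_mp) (phi : R -> R -> R) (r : R -> R) (N : nat) :
  (0 < N)%N -> continuous (fun p : R * R => phi p.1 p.2) ->
  (forall e, 0 < e -> exists C, forall x xi,
    `|phi x xi - r x * xi| <= e * `|xi| + C) ->
  (forall v, approx_solution etam etap alpha (fun x xi => r x * xi) N v 0 ->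
    forall i, (i <= N)%N -> v i = 0) ->
  exists v, approx_solution etam etap alpha phi N v 0.
Proof.
move=> N0 phic phir inj.
pose L := traj (fun x xi => r x * xi) N.
pose p := boundary_defect alpha.1 etam N 0 (L (1, 0)).
pose q := boundary_defect alpha.1 etam N 0 (L (0, 1)).
pose s := boundary_defect alpha.2 etap N N (L (1, 0)).
pose t := boundary_defect alpha.2 etap N N (L (0, 1)).
have lin m (a : 'rV[R]_m) (eta : 'I_m -> R) k z :
    boundary_defect a eta N k (L z) = z.1 * boundary_defect a eta N k (L (1, 0))
      + z.2 * boundary_defect a eta N k (L (0, 1)).
  rewrite (@eq_boundary_defect _ _ _ _ _ _ _
    (fun i => z.1 * L (1, 0) i + (z.2 * L (0, 1) i + 0))).
    rewrite !boundary_defectD; congr (_ + _); rewrite -[RHS]addr0; congr (_ + _).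
    by rewrite /boundary_defect big1 ?subrr // => j _; rewrite mulr0.
  by move=> i; rewrite addr0; exact: traj_linear.
have ker z : z.1 * p + z.2 * q = 0 -> z.1 * s + z.2 * t = 0 -> z = (0, 0).
  move=> k1 k2; suff h i : (i <= N)%N -> L z i = 0.
    have := h 0%N (leq0n _); have := h 1%N N0.
    by case: z {k1 k2 h} => a b; rewrite /L /traj /= => -> ->.
  apply: inj; split.
  - move=> j jN; rewrite /L trajSS -/L mulr0 (_ : `|_| = 0) //.
    by apply/eqP; rewrite normr_eq0; apply/eqP; ring.
  - by rewrite lin k1 normr0.
  - by rewrite lin k2 normr0.
(* for determinant 0 the columns of the adjugate matrix lie in the kernel,
   hence vanish, and then so do the linear defects of (1, 0) *)
have det0 : p * t - q * s != 0.
  apply/eqP => det0; have kerE a b : a * p + b * q = 0 -> a * s + b * t = 0 ->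
      a = 0 /\ b = 0 by move=> /(ker (a, b)) k /k[].
  have [||q0 /eqP] := kerE q (- p); [ring | by rewrite -oppr0 -det0; ring |].
  rewrite oppr_eq0 => /eqP p0; have [||t0 /eqP] := kerE t (- s).
  - by rewrite -det0; ring.
  - by ring.
  rewrite oppr_eq0 => /eqP s0; have [||/eqP] := kerE 1 0.
  - by rewrite p0; ring.
  - by rewrite s0; ring.
  by rewrite oner_eq0.
pose det := p * t - q * s.
pose F1 z := boundary_defect alpha.1 etam N 0 (traj phi N z).
pose F2 z := boundary_defect alpha.2 etap N N (traj phi N z).
have F1c : continuous F1.
  by apply: boundary_defect_continuous => i; exact: traj_continuous.
have F2c : continuous F2.
  by apply: boundary_defect_continuous => i; exact: traj_continuous.
have diff m (a : 'rV[R]_m) (eta : 'I_m -> R) k : sublinear (fun z =>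
    boundary_defect a eta N k (traj phi N z) - boundary_defect a eta N k (L z)).
  have := boundary_defect_sublinear a eta N k
    (v := fun z i => traj phi N z i - L z i) (fun i => traj_sublinear N i phir).
  apply: sublinear_ext => z; have := boundary_defectD a eta N k (-1) (L z) (traj phi N z).
  rewrite mulN1r addrC => <-.
  by apply: eq_boundary_defect => i; rewrite mulN1r addrC.
have comb c1 c2 : sublinear (fun z => c1 * (F1 z - (z.1 * p + z.2 * q))
    + c2 * (F2 z - (z.1 * s + z.2 * t))).
  have d1 := diff _ alpha.1 etam 0%N; have d2 := diff _ alpha.2 etap N.
  have := sublinearD c1 d1 (sublinearD c2 d2 (@sublinear0 R)).
  by apply: sublinear_ext => z; rewrite (lin _ _ _ _ z) (lin _ _ _ _ z) addr0.
have combc c1 c2 : continuous (fun z => c1 * F1 z + c2 * F2 z).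
  move=> z; apply: cvgD; apply: cvgMl_tmp; [exact: F1c | exact: F2c].
(* the inverse of the linear part, applied to (F1, F2) *)
have [|| z [z1 z2]] := zero_of_sublinear (combc (t / det) (- q / det))
  (combc (- s / det) (p / det)).
- apply: sublinear_ext (comb (t / det) (- q / det)) => z.
  by rewrite /det; field; exact: det0.
- apply: sublinear_ext (comb (- s / det) (p / det)) => z.
  by rewrite /det; field; exact: det0.
have F10 : F1 z = 0.
  have : p * (t / det * F1 z + - q / det * F2 z)
      + q * (- s / det * F1 z + p / det * F2 z) = F1 z.
    by rewrite /det; field; exact: det0.
  by rewrite z1 z2 => <-; ring.
have F20 : F2 z = 0.
  have : s * (t / det * F1 z + - q / det * F2 z)
      + t * (- s / det * F1 z + p / det * F2 z) = F2 z.
    by rewrite /det; field; exact: det0.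
  by rewrite z1 z2 => <-; ring.
exists (traj phi N z); split.
- move=> j jN; rewrite trajSS mulr0 (_ : `|_| = 0) //.
  by apply/eqP; rewrite normr_eq0; apply/eqP; ring.
- by rewrite -/(F1 z) F10 normr0.
- by rewrite -/(F2 z) F20 normr0.
Qed.

(** * Extension of the data and a priori bound *)

Lemma dquot_continuous (R : realType) (u : R -> R) (x : R) :
  cvg (dquot u x) -> u y @[y --> within `[-1, 1] (nbhs x)] --> u x.
Proof.
move=> /cvg_ex[/= l ul]; apply: (@has_deriv_I_continuous _ _ _ l) => e e0.
move/cvgrPdist_le : ul => /(_ e e0); rewrite near_withinE => -[d /= d0 dP].
exists (d / 2); first by rewrite divr_gt0.
move=> y yI yx; have [->|ynx] := eqVneq y x.
  by rewrite !subrr mulr0 subr0 normr0 mulr0.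
have := dP y _ ynx; rewrite itvI => /(_ _ yI); rewrite /ball /= distrC => dy.
have yx0 : 0 < `|y - x| by rewrite normr_gt0 subr_eq0.
have {}dy : `|l - (u y - u x) / (y - x)| <= e by apply: dy; lra.
rewrite (_ : _ - _ = - ((l - (u y - u x) / (y - x)) * (y - x))); last first.
  by rewrite mulrBl divfK ?subr_eq0 // opprB.
by rewrite normrN normrM ler_pM2r.
Qed.

(** Composition with this retraction onto [-1, 1] extends the data to all real
    x, which spares domain conditions in the continuity statements. *)
Definition clamp (R : realType) (x : R) : R := Num.max (-1) (Num.min 1 x).

Lemma clamp_itv (R : realType) (x : R) : -1 <= clamp x <= 1.
Proof.
by rewrite /clamp le_max lexx ge_max ge_min lexx /= andbT; lra.
Qed.

Lemma clampE (R : realType) (x : R) : -1 <= x <= 1 -> clamp x = x.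
Proof. by move=> /andP[x1 x2]; rewrite /clamp (min_idPr x2) (max_idPr x1). Qed.

Lemma clamp_continuous (R : realType) : continuous (@clamp R).
Proof.
move=> x; suff : {for x, continuous ((cst (-1) : R -> R^o) \max (cst 1 \min id))}.
  by [].
apply: continuous_max; first exact: cst_continuous.
by apply: continuous_min; [exact: cst_continuous | exact: cvg_id].
Qed.

Lemma continuous_comp_within (T V W : topologicalType) (A : set V)
    (F : V -> W) (g : T -> V) :
  (forall x, A x -> F y @[y --> within A (nbhs x)] --> F x) ->
  continuous g -> (forall t, A (g t)) -> continuous (F \o g).
Proof.
move=> Fc gc gA t P /= /(Fc _ (gA t)) PF.
have : nbhs t [set s | A (g s) -> P (F (g s))] := gc t _ PF.
by apply: filterS => s /=; apply.
Qed.

Lemma clamp_fst_continuous (R : realType) :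
  continuous (fun p : R * R => (clamp p.1, p.2)).
Proof.
move=> p; have c1 : clamp q.1 @[q --> p] --> clamp p.1.
  by apply: continuous_comp; [exact: cvg_fst | exact: clamp_continuous].
exact: cvg_pair c1 cvg_snd.
Qed.

(** For large xi this is the limit of phi(x, xi) / xi; the remaining xi lie in a
    compact set, where phi(x, xi) - r(x) xi is bounded. *)
Lemma asymptotically_linear (R : realType) (phi : R -> R -> R) (r : R -> R) :
  continuous (fun p : R * R => phi p.1 p.2) ->
  continuous (fun p : R * R => r p.1 * p.2) ->
  (forall e : R, 0 < e -> exists M : R, forall x xi : R, -1 <= x <= 1 ->
     M < `|xi| -> `|phi x xi / xi - r x| < e) ->
  forall e, 0 < e -> exists C, forall x xi, -1 <= x <= 1 ->
    `|phi x xi - r x * xi| <= e * `|xi| + C.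
Proof.
move=> phic rc lim e e0; have [M HM] := lim e e0.
have [|Q HQ] := @locally_bounded R (fun x xi => phi x xi - r x * xi) `|M|.
  by move=> p; apply: cvgB; [exact: phic | exact: rc].
exists `|Q| => x xi xI; have [xiM|xiM] := leP `|xi| `|M|.
  apply: le_trans (HQ x xi xI xiM) _; apply: le_trans (ler_norm Q) _.
  by rewrite lerDr mulr_ge0 // ltW.
have xi0 : xi != 0 by rewrite -normr_gt0; apply: le_lt_trans xiM.
rewrite -[X in X <= _]addr0 lerD // (_ : _ - _ = (phi x xi / xi - r x) * xi).
  rewrite normrM ler_pM2r ?normr_gt0 // ltW // HM //.
  by apply: le_lt_trans xiM; exact: ler_norm.
by rewrite mulrBl divfK.
Qed.

(** A discrete solution of maximum m for phi solves the linear equation with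
    residual at most e m + C; for e = 1 / (2 c) stability gives
    m <= m / 2 + c C. *)
Lemma a_priori_bound (R : realType) (mm mp : nat)
    (etam : 'I_mm -> R) (etap : 'I_mp -> R)
    (alpha : 'rV[R]_mm * 'rV[R]_mp) (phi : R -> R -> R) (r : R -> R)
    (c : R) (K : nat) : 0 < c ->
  (forall N v D, (K < N)%N ->
    approx_solution etam etap alpha (fun x xi => r x * xi) N v D ->
    forall i, (i <= N)%N -> `|v i| <= c * D) ->
  (forall e, 0 < e -> exists C, forall x xi,
    `|phi x xi - r x * xi| <= e * `|xi| + C) ->
  exists M, forall N v, (K < N)%N ->
    approx_solution etam etap alpha phi N v 0 ->
    forall i, (i <= N)%N -> `|v i| <= M.
Proof.
move=> c0 stab phir; have e0 : 0 < (2 * c)^-1 by rewrite invr_gt0 mulr_gt0.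
have [C HC] := phir _ e0; exists (2 * (c * C)) => N v KN [ve vm vp] i iN.
have [k kN kmax] := exists_max N v; apply: le_trans (kmax i iN) _.
have D0 : 0 <= (2 * c)^-1 * `|v k| + C.
  exact: le_trans (normr_ge0 _) (HC 0 (v k)).
have : `|v k| <= c * ((2 * c)^-1 * `|v k| + C).
  apply: (stab N v) kN => //; split; [|exact: le_trans D0|exact: le_trans D0].
  move=> j jN; have := ve j jN; rewrite mulr0 normr_le0 => /eqP vj.
  rewrite (_ : _ + _ = - (mesh R N ^+ 2 * (phi (node R N j.+1) (v j.+1)
      - r (node R N j.+1) * v j.+1))); last first.
    by rewrite mulrBr opprB; move: vj; lra.
  rewrite normrN normrM ger0_norm ?sqr_ge0 // ler_wpM2l ?sqr_ge0 //.
  apply: le_trans (HC _ _) _; rewrite lerD2r ler_pM2l //.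
  exact: kmax.
rewrite (_ : c * (_ + C) = `|v k| / 2 + c * C); first lra.
by field; rewrite gt_eqF.
Qed.

(** * Solvability *)

Theorem theorem5p1 (R : realType) (mm mp : nat)
    (mm_ge1 : (1 <= mm)%N) (mp_ge1 : (1 <= mp)%N)
    (etam : 'I_mm -> R) (etap : 'I_mp -> R)
    (etam_I : forall i, etam i \in `[-1, 1] /\ etam i != -1)
    (etap_I : forall i, etap i \in `[-1, 1] /\ etap i != 1)
    (f : R -> R -> R)
    (f_cont : {within `[-1, 1] `*` setT, continuous (fun p => f p.1 p.2)})
    (rinf : R -> R) (rinf_C1 : C_I 1 rinf)
    (rinf_gt0 : {in `[-1, 1], forall x, 0 < rinf x})
    (f_rinf : forall e : R, 0 < e -> exists M : R,
       forall x xi : R, x \in `[-1, 1] -> M < `|xi| ->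
       `|f x xi / xi - rinf x| < e)
    (gamma : R) (gammaP : spectral_bound etam etap rinf gamma)
    (alpha : 'rV[R]_mm * 'rV[R]_mp) (alpha_lt : A_ gamma alpha)
    (lambda : nat -> R)
    (lambdaP : is_spectrum etam etap alpha rinf lambda)
    (nonresonance : forall k, (1 <= k)%N -> lambda k != 1) :
  exists2 u : R -> R, X_ etam etap alpha u &
    {in `]-1, 1[, forall x, - deriv_I (deriv_I u) x = f x (u x)}.
Proof.
have etamI i : -1 <= etam i <= 1 by rewrite -itvI; have [] := etam_I i.
have etapI i : -1 <= etap i <= 1 by rewrite -itvI; have [] := etap_I i.
pose phi x xi := f (clamp x) xi; pose r x := rinf (clamp x).
have phic : continuous (fun p : R * R => phi p.1 p.2).
  pose g (p : R * R) := (clamp p.1, p.2).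
  suff : continuous ((fun p : R * R => f p.1 p.2) \o g) by [].
  apply: (continuous_comp_within
    (A := ([set` `[-1, 1]] : set R) `*` (setT : set R))).
  - exact/subspace_continuousP.
  - exact: clamp_fst_continuous.
  - by move=> p; split=> //=; rewrite itvI clamp_itv.
have rc : continuous (fun p : R * R => r p.1 * p.2).
  have r1 : continuous r.
    suff : continuous (rinf \o @clamp R) by [].
    apply: (continuous_comp_within (A := [set` `[-1, 1]] : set R)).
    - by move=> x xI; apply: dquot_continuous; have [+ _] := rinf_C1; apply.
    - exact: clamp_continuous.
    - by move=> x /=; rewrite itvI clamp_itv.
  move=> p; apply: cvgM; last exact: cvg_snd.
  by apply: continuous_comp; [exact: cvg_fst | exact: r1].
have phir e : 0 < e -> exists C, forall x xi,
    `|phi x xi - r x * xi| <= e * `|xi| + C.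
  move=> e0; have [|C HC] := asymptotically_linear phic rc _ e0.
    move=> d d0; have [M HM] := f_rinf d d0; exists M => x xi xI.
    by rewrite /phi /r clampE //; apply: HM; rewrite itvI.
  exists C => x xi; have := HC (clamp x) xi (clamp_itv x).
  by rewrite /phi /r (clampE (clamp_itv x)).
have noneig u : X_ etam etap alpha u ->
    (forall x, -1 <= x <= 1 -> - deriv_I (deriv_I u) x = r x * u x) ->
    forall x, -1 <= x <= 1 -> u x = 0.
  move=> uX uE x xI; apply/eqP/negPn/negP => ux0.
  have [/(_ 1)[+ _] _ _ _ _] := lambdaP; case.
    exists u; split=> //; first by exists x; rewrite ?itvI.
    by move=> y; rewrite itvI => yI; rewrite mul1r uE // /r clampE.
  by move=> k k1 lk; have := nonresonance k k1; rewrite -lk eqxx.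
have [c c0 [K stab]] := discrete_stability etamI etapI rc noneig.
have [M HM] := a_priori_bound c0 stab phir.
have ex n : exists v, approx_solution etam etap alpha phi (n + K).+1 v 0.
  apply: discrete_existence phic phir _ => // v v0 i iN.
  have := stab _ v 0 _ v0 i iN; rewrite mulr0 normr_le0 ltnS leq_addl.
  by move=> /(_ isT)/eqP.
have [v vP] := choice ex.
have [|n i iN|n|u [uX uE] _] := @discrete_limit R mm mp etam etap etamI etapI
    alpha phi phic (fun n => (n + K).+1) _ v M.
- by move=> n; rewrite ltnS leq_addr.
- by apply: HM (vP n) _ iN; rewrite ltnS leq_addl.
- by apply: approx_solution_le (vP n); rewrite invr_ge0.
exists u => // x; rewrite in_itv /= => /andP[/ltW x1 /ltW x2].
have xI : -1 <= x <= 1 by rewrite x1.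
by rewrite uE // /phi clampE.
Qed.
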